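(* Let $G$ be a finite group of composite order. Then the following are equivalent: (a) $G$ has no nontrivial proper subgroup that is a perfect code of $G$; (b) $G$ is a $2$-group with a unique involution; (c) $G$ is either a cyclic $2$-group or a generalized quaternion $2$-group.
   Context: All groups and graphs are finite; graphs are undirected and simple. $e$ denotes the identity element. For a group $G$ and an inverse-closed subset $S\subseteq G\setminus\{e\}$, the Cayley graph $\mathrm{Cay}(G,S)$ has vertex set $G$, with $x,y$ adjacent iff $yx^{-1}\in S$. A subset $C$ of the vertex set of a graph $\Gamma$ is a perfect code in $\Gamma$ if every vertex of $\Gamma$ is at distance at most $1$ from exactly one vertex of $C$. A subset $C$ of a group $G$ is a perfect code of $G$ if $C$ is a perfect code in some Cayley graph of $G$. A generalized quaternion group is a group of order $4n$, for some integer $n\geq 2$, with presentation $\langle a,b\mid a^{2n}=e,\ b^2=a^n,\ b^{-1}ab=a^{-1}\rangle$; a generalized quaternion $2$-group is one whose order is a power of $2$. *)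

(* Defs.v *)
From mathcomp Require Import all_boot all_fingroup all_solvable.

Set Implicit Arguments.
Unset Strict Implicit.
Unset Printing Implicit Defensive.

Local Open Scope group_scope.

(* A graph on a subset V of a finType T is given by V and an edge relation on T
   that only relates points of V. *)

Definition dist_le (T : finType) (e : rel T) (k : nat) (x y : T) : Prop :=
  exists p : seq T, [/\ path e x p, last x p = y & size p <= k].

Definition perfect_code_in (T : finType) (V : {set T}) (e : rel T)
    (C : {set T}) : Prop :=
  C \subset V /\
  forall x, x \in V -> exists! c, c \in C /\ dist_le e 1 x c.

Definition connection_set (gT : finGroupType) (G S : {set gT}) : Prop :=
  S \subset G :\ 1 /\ (forall x, x \in S -> x^-1 \in S).

Definition cayley (gT : finGroupType) (G S : {set gT}) : rel gT :=
  fun x y => [&& x \in G, y \in G & y * x^-1 \in S].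

Lemma cayley_sym (gT : finGroupType) (G S : {set gT}) :
  connection_set G S -> symmetric (cayley G S).
Proof.
case=> _ SV x y; rewrite /cayley andbCA; congr [&& _, _ & _].
by apply/idP/idP=> /SV; rewrite invMg invgK.
Qed.

Lemma cayley_irr (gT : finGroupType) (G S : {set gT}) :
  connection_set G S -> irreflexive (cayley G S).
Proof.
case=> /subsetP sS _ x; rewrite /cayley mulgV.
by case: (boolP (1 \in S)) => [/sS|_]; rewrite ?setD11 ?andbF.
Qed.

Definition perfect_code_of (gT : finGroupType) (G C : {set gT}) : Prop :=
  exists S : {set gT}, connection_set G S /\ perfect_code_in G (cayley G S) C.

(* [\isog Grp] compares G with the largest finite quotient of the presented
   group; the group presented here is finite, so this is an isomorphism. *)
Definition generalized_quaternion (gT : finGroupType) (G : {set gT}) : Prop :=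
  exists n : nat, [/\ 2 <= n, #|G| = (4 * n)%N
    & G \isog Grp (a : b : a ^+ (2 * n), b ^+ 2 = a ^+ n, a ^ b = a^-1)].

(* Main.v *)
Require Import Defs.
From mathcomp Require Import all_boot all_fingroup all_solvable.

Local Open Scope group_scope.

(** A subgroup H of G is a perfect code iff some inverse-closed T in G meets
every right coset Hx outside H exactly once. A maximal inverse-closed partial
transversal T is complete as soon as every double coset HxH that is closed under
inversion and consists of an odd number of right cosets contains some y with
y^-1 = y: two cosets Hx and Hx' missed by T, with x' in Hx^-1H, could be hit by
a pair s, s^-1, and parity rules out the rest. This holds when H has odd order,
so a group of composite order without proper nontrivial subgroup codes is a
2-group. If a 2-group G has involutions z != t, then a subgroup H containing t
and maximal among those avoiding z is a code: when x normalises H and x^2 is in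
H but x is not, the group H U Hx contains z, so z is in Hx. Conversely, if z is
the only involution of the 2-group G and H is a proper nontrivial code, choose x
in N_G(H) outside H with x^2 in H; the representative of Hx = Hx^-1 is its own
inverse, hence equals z, which lies in H. *)

(** * Subgroup codes as inverse-closed transversals *)

Section InverseClosedTransversals.

Variables (gT : finGroupType) (G H : {group gT}).
Implicit Types (A T U D : {set gT}) (x y s : gT).

Lemma dist_le1_cayley T x y :
  x \in G -> y \in G ->
  dist_le (cayley G T) 1 x y <-> x = y \/ y * x^-1 \in T.
Proof.
move=> Gx Gy; split=> [[[|z [|? ?]] [//= exz <- _]] | [-> | Txy]].
- by left.
- by case/andP: exz => /and3P[]; right.
- by exists [::].
by exists [:: y]; rewrite /= /cayley Gx Gy Txy.
Qed.

(** For [x] outside [H], the points of [H] within distance 1 of the vertex [x^-1] are the [h] with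
    [h * x] in the connection set, so they correspond to its points in the coset [H :* x]. *)
Lemma subgroup_perfect_codeP :
  H \subset G ->
  perfect_code_of G H <->
  exists T, [/\ T \subset G, {in T, forall t, t^-1 \in T}
    & forall x, x \in G :\: H -> exists! t, t \in T :&: H :* x].
Proof.
move=> sHG; split=> [[S [[sSG SV] [_ codeH]]] | [T [sTG TV transT]]].
  exists S; split=> // [|x /setDP[Gx notHx]].
    by rewrite (subset_trans sSG) ?subD1set.
  have [|h [[Hh dxh] hU]] := codeH x^-1; first by rewrite groupV.
  have Gh := subsetP sHG h Hh.
  have [/(canRL invgK) def_x | Shx] :=
    (dist_le1_cayley S x^-1 h (groupVr Gx) Gh).1 dxh.
    by rewrite def_x groupV Hh in notHx.
  rewrite invgK in Shx; exists (h * x).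
  split=> [|t /setIP[St Hxt]]; first by rewrite inE Shx mem_rcoset mulgK.
  rewrite (hU (t * x^-1)) ?mulgKV //; rewrite mem_rcoset in Hxt; split=> //.
  apply/(dist_le1_cayley _ _ _ (groupVr Gx) (subsetP sHG _ Hxt)).
  by rewrite invgK mulgKV; right.
(* [T] is free to meet [H]; dropping that part leaves no edges inside [H] and keeps 1 out of the
   connection set. *)
exists (T :\: H); split; [split | split=> // x Gx].
- apply/subsetP=> t /setDP[Tt notHt]; rewrite !inE (subsetP sTG) // andbT.
  by apply: contraNneq notHt => ->.
- by move=> t /setDP[Tt notHt]; rewrite inE groupV notHt TV.
have [Hx | notHx] := boolP (x \in H).
  exists x; split=> [|h [Hh]].
    by split=> //; apply/dist_le1_cayley => //; left.
  case/(dist_le1_cayley _ _ _ Gx (subsetP sHG _ Hh)) => // /setDP[_].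
  by rewrite groupM ?groupV.
have [|t [/setIP[Tt Hxt] tU]] := transT x^-1; first by rewrite inE !groupV notHx.
rewrite mem_rcoset invgK in Hxt.
exists (t * x); split=> [|h [Hh]].
  split=> //; apply/(dist_le1_cayley _ _ _ Gx (subsetP sHG _ Hxt)); right.
  rewrite mulgK inE Tt andbT.
  by apply: contra notHx => Ht; rewrite -(groupMl _ Ht).
case/(dist_le1_cayley _ _ _ Gx (subsetP sHG _ Hh)) => [def_x | /setDP[Thx _]].
  by rewrite def_x Hh in notHx.
by rewrite (tU (h * x^-1)) ?mulgKV // inE Thx mem_rcoset invgK mulgKV.
Qed.

(** * Partial transversals and ways to enlarge them *)

Definition partial_transversal T :=
  [&& T \subset G, [forall t in T, t^-1 \in T]
    & [forall t in T, forall u in T, (u \in H :* t) ==> (u == t)]].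

Lemma partial_transversalP T :
  reflect [/\ T \subset G, {in T, forall t, t^-1 \in T}
             & {in T &, forall t u, u \in H :* t -> u = t}]
          (partial_transversal T).
Proof.
apply: (iffP and3P) => [[sTG /forall_inP TV /forall_inP injT]|[sTG TV injT]].
  split=> // t u Tt Tu Htu; apply/eqP.
  by have /forall_inP/(_ _ Tu)/implyP := injT t Tt; apply.
split=> //; first exact/forall_inP.
apply/forall_inP=> t Tt; apply/forall_inP=> u Tu; apply/implyP=> Htu.
by apply/eqP/injT.
Qed.

Lemma disjoint_rcosetP T x :
  reflect {in T, forall t, t \notin H :* x} [disjoint T & H :* x].
Proof. by rewrite disjoint_subset; apply: (iffP subsetP). Qed.

Lemma partial_transversalD T U :
  partial_transversal T -> {in U, forall u, u^-1 \in U} ->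
  partial_transversal (T :\: U).
Proof.
case/partial_transversalP=> sTG TV injT UV.
apply/partial_transversalP; split=> [|t|t u].
- by rewrite subDset subsetU // sTG orbT.
- case/setDP=> Tt notUt; rewrite inE TV // andbT.
  by apply: contra notUt => /UV; rewrite invgK.
by case/setDP=> Tt _ /setDP[Tu _]; apply: injT.
Qed.

Lemma partial_transversal_addU T U :
  partial_transversal T -> partial_transversal U ->
  {in U, forall u, [disjoint T & H :* u]} -> partial_transversal (U :|: T).
Proof.
case/partial_transversalP=> sTG TV injT /partial_transversalP[sUG UV injU] tiTU.
apply/partial_transversalP; split=> [|t|t u].
- by rewrite subUset sUG.
- by case/setUP=> [/UV|/TV] Vt; rewrite inE Vt ?orbT.
case/setUP=> [Ut|Tt] /setUP[Uu|Tu]; [exact: injU | | | exact: injT].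
  by move/disjoint_rcosetP: (tiTU t Ut) => /(_ u Tu)/negPf->.
rewrite rcoset_sym.
by move/disjoint_rcosetP: (tiTU u Uu) => /(_ t Tt)/negPf->.
Qed.

Lemma disjoint_rcoset_trans T x y :
  y \in H :* x -> [disjoint T & H :* y] = [disjoint T & H :* x].
Proof. by move/rcoset_eqP->. Qed.

Lemma partial_transversal_add1 T y :
    partial_transversal T -> y \in G -> y^-1 = y -> [disjoint T & H :* y] ->
  partial_transversal (y |: T).
Proof.
move=> ptT Gy yV tiTy; apply: partial_transversal_addU => // [|u /set1P-> //].
apply/partial_transversalP; rewrite sub1set; split=> // [t | t u] /set1P->.
  by rewrite yV set11.
by move/set1P->.
Qed.

(** Every right coset in [H :* x^-1 * H] contains the inverse of a point of [H :* x], so one pair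
    [s], [s^-1] fills both missed cosets. *)
Lemma partial_transversal_add2 T x x' :
    H \subset G -> partial_transversal T -> x \in G ->
    [disjoint T & H :* x] -> [disjoint T & H :* x'] ->
    x' \notin H :* x -> x' \in H :* x^-1 * H ->
  exists2 U, partial_transversal U & #|U| = #|T|.+2.
Proof.
move=> sHG ptT Gx tiTx tiTx' notHxx' /mulsgP[_ k /rcosetP[h Hh ->] Hk def_x'].
(* From [x' = h * x^-1 * k] it follows that [s^-1 = x^-1 * k = h^-1 * x']. *)
pose s := k^-1 * x.
have Hxs: s \in H :* x by rewrite mem_rcoset mulgK groupV.
have Hx's: s^-1 \in H :* x'.
  by rewrite rcoset_sym mem_rcoset invgK def_x' /s mulgA mulgK mulgKV.
have notHsV: s^-1 \notin H :* s.
  by rewrite (rcoset_eqP Hxs); apply: contra notHxx' => /rcoset_eqP<-;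
     rewrite (rcoset_eqP Hx's) rcoset_refl.
have Gs: s \in G by rewrite groupM ?groupV ?(subsetP sHG k).
have notTs: s \notin T.
  by apply: contraL Hxs => Ts; apply: (disjoint_rcosetP _ _ tiTx).
have notTsV: s^-1 \notin T.
  by apply: contraL Hx's => Ts; apply: (disjoint_rcosetP _ _ tiTx').
have neq_s: s != s^-1 by apply: contraNneq notHsV => <-; apply: rcoset_refl.
exists ([set s; s^-1] :|: T).
  apply: partial_transversal_addU => // [|u /set2P[]->].
  - apply/partial_transversalP; split=> [|t|t u].
    + by rewrite subUset !sub1set groupV Gs.
    + by case/set2P=> ->; rewrite ?invgK !inE eqxx ?orbT.
    case/set2P=> -> /set2P[]-> //; first by rewrite (negPf notHsV).
    by rewrite rcoset_sym (negPf notHsV).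
  - by rewrite (disjoint_rcoset_trans _ _ _ Hxs).
  by rewrite (disjoint_rcoset_trans _ _ _ Hx's).
by rewrite -setUA !cardsU1 !inE (negPf neq_s) (negPf notTs) (negPf notTsV).
Qed.

(** * Double cosets and maximal partial transversals *)

Lemma card_mul_transversal A :
  {in A &, forall t u, u \in H :* t -> u = t} -> #|H * A| = (#|H| * #|A|)%N.
Proof.
move=> injA; rewrite -cardsX /mulg /= /set_mulg curry_imset2X.
apply: card_in_imset => -[h t] [k u] /setXP[/= Hh At] /setXP[/= Hk Au].
move=> /= eq_htku.
have eq_ut: u = t.
  apply: injA => //; rewrite mem_rcoset.
  have ->: u * t^-1 = k^-1 * h by rewrite -(canLR (mulKg k) eq_htku) mulgA mulgK.
  by rewrite groupM ?groupV.
by rewrite eq_ut in eq_htku *; rewrite (mulIg t _ _ eq_htku).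
Qed.

(** Inversion has no fixed point on [D], so [D] splits into pairs [y], [y^-1]. *)
Lemma even_card_inverse_closed D :
  {in D, forall y, y^-1 \in D} -> {in D, forall y, y^-1 != y} -> ~~ odd #|D|.
Proof.
move: {2}#|D|.+1 (ltnSn #|D|) => n.
elim: n D => // n IHn D leDn DV Dneq.
have [-> | [y Dy]] := set_0Vmem D; first by rewrite cards0.
have DyV: y^-1 \in D :\ y by rewrite !inE Dneq ?DV.
have oD: #|D| = #|D :\ y :\ y^-1|.+2.
  by rewrite (cardsD1 y) Dy (cardsD1 y^-1 (D :\ y)) DyV.
rewrite oD /= negbK; apply: IHn => [|z|z].
- by rewrite oD in leDn; rewrite ltnW.
- rewrite !inE => /and3P[zyV zy Dz]; rewrite DV // andbT.
  by rewrite (inj_eq invg_inj) zy (canF_eq invgK) zyV.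
by rewrite !inE => /and3P[_ _]; apply: Dneq.
Qed.

Lemma dcosetP x y :
  reflect (exists2 h, h \in H & exists2 k, k \in H & y = h * x * k)
          (y \in H :* x * H).
Proof.
apply: (iffP mulsgP) => [[_ k /rcosetP[h Hh ->] Hk ->] | [h Hh [k Hk ->]]].
  by exists h => //; exists k.
by exists (h * x) k; rewrite ?mem_rcoset ?mulgK.
Qed.

(** Translation by [x^-1] turns the double coset into the product of [H :^ x] and [H]. The index is
    thus its number of right cosets of [H]. *)
Lemma card_dcoset x : #|H :* x * H| = (#|H| * #|H :^ x : H|)%N.
Proof.
apply/eqP; rewrite -(eqn_pmul2r (cardG_gt0 (H :^ x :&: H))) -mulnA.
rewrite [(#|_ : _| * _)%N]mulnC LagrangeI [(#|H| * _)%N]mulnC mul_cardG.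
rewrite eqn_pmul2r ?cardG_gt0 //.
have ->: H :* x * H = x *: (H :^ x * H).
  by rewrite mulgA conjsgE lcosetKV.
by rewrite card_lcoset.
Qed.

Lemma dcoset_refl x : x \in H :* x * H.
Proof. by apply/dcosetP; exists 1 => //; exists 1; rewrite ?mulg1 ?mul1g. Qed.

Lemma dcoset_trans {x y z} :
  y \in H :* x * H -> z \in H :* y * H -> z \in H :* x * H.
Proof.
case/dcosetP=> h Hh [k Hk ->] /dcosetP[h' Hh' [k' Hk' ->]].
apply/dcosetP; exists (h' * h); first exact: groupM.
by exists (k * k'); rewrite ?groupM // !mulgA.
Qed.

Lemma rcoset_sub_dcoset x : H :* x \subset H :* x * H.
Proof. exact: mulG_subl. Qed.

Lemma invg_dcoset x : (H :* x * H)^-1 = H :* x^-1 * H.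
Proof. by rewrite !invMg invGid invg_set1 mulgA. Qed.

Lemma dcosetV x y : (y^-1 \in H :* x^-1 * H) = (y \in H :* x * H).
Proof. by rewrite -invg_dcoset mem_invg invgK. Qed.

(** If [T] misses [H :* x], exchanges that would enlarge [T] show that it hits every other right
    coset in [D] and that [D] has no self-inverse element. Counting representatives then gives a
    contradiction. *)
Lemma maximal_partial_transversal_hits T x :
    H \subset G -> partial_transversal T ->
    (forall U, partial_transversal U -> #|U| <= #|T|) ->
    (x^-1 \in H :* x * H -> odd #|H :^ x : H| ->
       exists2 y, y \in H :* x * H & y^-1 = y) ->
  x \in G -> ~~ [disjoint T & H :* x].
Proof.
move=> sHG ptT Tmax invD Gx; apply/negP=> tiTx.
have [sTG TV injT] := partial_transversalP _ ptT.
pose D := H :* x^-1 * H.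
have sDG: D \subset G by rewrite mul_subG ?mul_subG ?sub1set ?groupV.
have hitD x': x' \in D -> x' \notin H :* x -> exists2 t, t \in T & t \in H :* x'.
  move=> Dx' notHxx'; have [tiTx' | ] := boolP [disjoint T & H :* x']; last first.
    by rewrite -setI_eq0 => /set0Pn[t /setIP[]]; exists t.
  have [U ptU oU] :=
    partial_transversal_add2 _ _ _ sHG ptT Gx tiTx tiTx' notHxx' Dx'.
  by have := Tmax U ptU; rewrite oU ltnNge leqnSn.
(* An involution u of T in D could be traded for a pair s, s^-1 lying in Hx and Hu. *)
have noInvT u: u \in T -> u \in D -> u^-1 != u.
  move=> Tu Du; apply/eqP=> uV.
  have ptTu: partial_transversal (T :\ u).
    by apply: partial_transversalD => // _ /set1P->; rewrite uV set11.
  have [||||U ptU oU] := partial_transversal_add2 (T :\ u) x u sHG ptTu Gx.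
  - exact: disjointWl (subD1set _ _) tiTx.
  - apply/disjoint_rcosetP=> t /setD1P[neq_tu Tt].
    by apply: contra neq_tu => /injT->.
  - exact: (disjoint_rcosetP _ _ tiTx).
  - exact: Du.
  by have := Tmax U ptU; rewrite oU (cardsD1 u T) Tu ltnn.
(* An involution y of D could enter T in place of the representative u of Hy,
   which frees Hu^-1 to be paired with Hx. *)
have noInvD y: y \in D -> y^-1 != y.
  move=> Dy; apply/eqP=> yV; have Gy := subsetP sDG y Dy.
  have [Hxy | notHxy] := boolP (y \in H :* x).
    have tiTy: [disjoint T & H :* y] by rewrite (rcoset_eqP Hxy).
    have := Tmax _ (partial_transversal_add1 _ _ ptT Gy yV tiTy).
    rewrite cardsU1 (contraL (disjoint_rcosetP _ _ tiTy y)) ?rcoset_refl //.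
    by rewrite ltnn.
  have [u Tu Hyu] := hitD y Dy notHxy.
  have Du: u \in D.
    exact: dcoset_trans Dy (subsetP (rcoset_sub_dcoset _) _ Hyu).
  have uneq := noInvT u Tu Du; pose T0 := T :\: [set u; u^-1].
  have ptT0: partial_transversal T0.
    apply: partial_transversalD => // _ /set2P[]->;
      by rewrite !inE ?invgK eqxx ?orbT.
  have tiT0y: [disjoint T0 & H :* y].
    apply/disjoint_rcosetP=> t; rewrite !inE negb_or => /andP[/andP[neq_tu _] Tt].
    by rewrite -(rcoset_eqP Hyu); apply: contra neq_tu => /injT->.
  have ptT1 := partial_transversal_add1 _ _ ptT0 Gy yV tiT0y.
  have oT: #|T| = #|T0|.+2.
    have TuV: u^-1 \in T :\ u by rewrite !inE uneq TV.
    by rewrite (cardsD1 u) Tu (cardsD1 u^-1 (T :\ u)) TuV setDDl.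
  have oT1: #|y |: T0| = #|T0|.+1.
    by rewrite cardsU1 (contraL (disjoint_rcosetP _ _ tiT0y y)) ?rcoset_refl.
  have [||||U ptU oU] := partial_transversal_add2 (y |: T0) x u^-1 sHG ptT1 Gx.
  - apply/disjoint_rcosetP=> t /setU1P[-> // | /setDP[Tt _]].
    exact: (disjoint_rcosetP _ _ tiTx).
  - apply/disjoint_rcosetP=> t /setU1P[-> | /setDP[Tt neq_t]].
      apply: contra uneq => HyuV; rewrite rcoset_sym -(rcoset_eqP Hyu) in HyuV.
      by rewrite (injT _ _ Tu (TV u Tu)).
    apply: contra neq_t => Hut; rewrite !inE.
    by rewrite (injT _ _ (TV u Tu) Tt Hut) eqxx orbT.
  - exact: (disjoint_rcosetP _ _ tiTx) (TV u Tu).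
  - apply: dcoset_trans Dy _; rewrite -{1}yV dcosetV.
    exact: subsetP (rcoset_sub_dcoset _) _ Hyu.
  by have := Tmax U ptU; rewrite oU oT oT1 ltnn.
have notTx: x \notin T.
  by apply: contraL (rcoset_refl H x) => /(disjoint_rcosetP _ _ tiTx).
have injxT B: {in x |: (T :&: B) &, forall t u, u \in H :* t -> u = t}.
  move=> t u /setU1P[-> | /setIP[Tt _]] /setU1P[-> // | /setIP[Tu _]].
  - by move/(disjoint_rcosetP _ _ tiTx): Tu => /negPf->.
  - by rewrite rcoset_sym; move/(disjoint_rcosetP _ _ tiTx): Tt => /negPf->.
  exact: injT.
have Hfill y t: y \in D -> t \in H :* y -> t \in D.
  by move=> Dy Hyt; apply: dcoset_trans Dy (subsetP (rcoset_sub_dcoset _) _ Hyt).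
have oDV: #|H :* x * H| = #|D| by rewrite /D -invg_dcoset card_invg.
(* If [x] is in [D], then [D] is closed under inversion. Its right cosets are [H :* x] and those
   represented by [T :&: D], a set of even size. Their number is odd, so [invD] supplies a forbidden
   self-inverse element. *)
have [Dx | notDx] := boolP (x \in D).
  have eqDV: H :* x * H = D.
    apply/eqP; rewrite eqEcard oDV leqnn andbT.
    by apply/subsetP=> y; apply: dcoset_trans.
  have defD: H * (x |: (T :&: D)) = D.
    apply/eqP; rewrite eqEsubset; apply/andP; split; apply/subsetP=> y.
      case/mulsgP=> h t Hh DTt ->; apply: (Hfill t).
        by case/setU1P: DTt => [-> | /setIP[]].
      by rewrite mem_rcoset mulgK.
    move=> Dy; have [Hxy | notHxy] := boolP (y \in H :* x).
      by apply: subsetP Hxy; rewrite mulgS // sub1set setU11.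
    have [t Tt Hyt] := hitD y Dy notHxy.
    have Dt := Hfill y t Dy Hyt; rewrite rcoset_sym in Hyt.
    by apply: subsetP Hyt; rewrite mulgS // sub1set setU1r // inE Tt.
  have [||y] := invD; last by rewrite eqDV => /noInvD/eqP.
    by rewrite eqDV dcoset_refl.
  have /eqP := card_dcoset x; rewrite eqDV -{1}defD card_mul_transversal //.
  rewrite eqn_pmul2l // => /eqP <-; rewrite cardsU1 inE (negPf notTx) /=.
  apply: even_card_inverse_closed => t /setIP[Tt Dt]; last exact: noInvT.
  by rewrite inE TV //= -eqDV -[x]invgK dcosetV.
(* Otherwise [T] represents every coset of [D], and as many cosets of [D^-1]; the missed coset of
   [x] in [D^-1] is then one too many, since both sets have the same size. *)
have defD: H * (T :&: D) = D.
  apply/eqP; rewrite eqEsubset; apply/andP; split; apply/subsetP=> y.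
    case/mulsgP=> h t Hh /setIP[_ Dt] ->; apply: (Hfill t) => //.
    by rewrite mem_rcoset mulgK.
  move=> Dy; have [|t Tt Hyt] := hitD y Dy.
    by apply: contra notDx; rewrite rcoset_sym; apply: Hfill.
  have Dt := Hfill y t Dy Hyt; rewrite rcoset_sym in Hyt.
  by apply: subsetP Hyt; rewrite mulgS // sub1set inE Tt.
have sDV: H * (x |: (T :&: D^-1)) \subset D^-1.
  have defDV: H * D^-1 = D^-1 by rewrite invg_dcoset invgK !mulgA mulGid.
  by rewrite -{2}defDV mulgS // subUset sub1set subsetIr invg_dcoset invgK dcoset_refl.
have oTD: #|T :&: D^-1| = #|T :&: D|.
  rewrite -card_invg; apply: eq_card => t; rewrite !inE invgK.
  by congr (_ && _); apply/idP/idP=> /TV; rewrite ?invgK.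
have := subset_leq_card sDV.
rewrite card_invg -{2}defD !card_mul_transversal //; last first.
  by move=> t u /setIP[Tt _] /setIP[Tu _]; apply: injT.
by rewrite leq_pmul2l ?cardG_gt0 // cardsU1 inE (negPf notTx) oTD ltnn.
Qed.

(** * Criteria for a subgroup to be a code *)

Lemma perfect_code_of_dcosets :
    H \subset G ->
    (forall x, x \in G -> x^-1 \in H :* x * H ->
       odd #|H :^ x : H| ->
       exists2 y, y \in H :* x * H & y^-1 = y) ->
  perfect_code_of G H.
Proof.
move=> sHG invD; apply/subgroup_perfect_codeP=> //.
have pt0: partial_transversal set0.
  by apply/partial_transversalP; split=> [|t|t u]; rewrite ?sub0set ?inE.
have [T ptT Tmax] := arg_maxnP (fun U : {set gT} => #|U|) pt0.
have [sTG TV injT] := partial_transversalP _ ptT.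
exists T; split=> // x /setDP[Gx _].
have := maximal_partial_transversal_hits T x sHG ptT Tmax (invD x Gx) Gx.
rewrite -setI_eq0 => /set0Pn[t TxHt]; exists t; split=> // u.
case/setIP: TxHt => Tt Hxt /setIP[Tu Hxu]; apply/esym/injT => //.
by rewrite (rcoset_eqP Hxt).
Qed.

(** An odd number of right cosets of odd size makes the double coset odd, so inversion fixes a point
    of it. *)
Lemma odd_subgroup_perfect_code :
  H \subset G -> odd #|H| -> perfect_code_of G H.
Proof.
move=> sHG oddH; apply: perfect_code_of_dcosets => // x Gx DxV odd_x.
have [/exists_inP[y Dy /eqP yV] | noInv] :=
  boolP [exists y in H :* x * H, y^-1 == y]; first by exists y.
have/negP[] : ~~ odd #|H :* x * H|; last by rewrite card_dcoset oddM oddH.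
apply: even_card_inverse_closed => y Dy.
  by apply: dcoset_trans DxV _; rewrite dcosetV.
by apply: contra noInv => yV; apply/exists_inP; exists y.
Qed.

(** The index is a power of 2, so it is odd only when [x] normalises [H]. Then the double coset is
    [H :* x], and closure under inversion means that [x ^+ 2] is in [H]. *)
Lemma two_group_perfect_code :
    2.-group G -> H \subset G ->
    (forall x, x \in 'N_G(H) -> x ^+ 2 \in H ->
       exists2 y, y \in H :* x & y^-1 = y) ->
  perfect_code_of G H.
Proof.
move=> p2G sHG invN; apply: perfect_code_of_dcosets => // x Gx DxV odd_x.
have Nx: x \in 'N(H).
  rewrite inE -indexg_eq1; apply/eqP.
  apply: (@pnat_1 2); last by rewrite -odd_2'nat.
  by apply: pnat_dvd (dvdn_indexg _ _) _; rewrite cardJg; apply: pgroupS p2G.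
have defD: H :* x * H = H :* x by rewrite norm_rlcoset // -mulgA mulGid.
rewrite defD in DxV *; apply: invN; first by rewrite inE Gx.
by rewrite -groupV expgS expg1 invMg -mem_rcoset.
Qed.

End InverseClosedTransversals.

(** * Subgroups and involutions of p-groups *)

Lemma exists_normaliser_expg_mem (gT : finGroupType) (p : nat) (G H : {group gT}) :
    p.-group G -> H \proper G ->
  exists2 x, x \in 'N_G(H) & x ^+ p \in H /\ x \notin H.
Proof.
move=> pG prHG; have prHN := nilpotent_proper_norm (pgroup_nil pG) prHG.
have nHN: 'N_G(H) \subset 'N(H) := subsetIr _ _.
(* Normalisers grow in a p-group, so Cauchy's theorem gives an element of order [p] in this
   quotient; [x] is a lift of it. *)
have ntNH: 'N_G(H) / H != 1 by rewrite -subG1 quotient_sub1 ?proper_subn.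
have pNH: p.-group ('N_G(H) / H).
  by rewrite quotient_pgroup ?(pgroupS _ pG) ?subsetIl.
have [p_pr p_dvd _] := pgroup_pdiv pNH ntNH.
have [_ /morphimP[x nHx Nx ->] ox] := Cauchy p_pr p_dvd.
exists x => //; split.
  by rewrite coset_idr ?groupX // morphX // -ox expg_order.
by apply: contraTN p_pr => Hx; rewrite -ox /= coset_id // order1.
Qed.

Lemma maxgroup_avoiding_perfect_code (gT : finGroupType) (G H : {group gT}) z :
    2.-group G -> z \in G -> #[z] = 2 ->
    [max H | (H \subset G) && (z \notin H)] ->
  perfect_code_of G H.
Proof.
move=> p2G Gz oz /maxgroupP[/andP[sHG notHz] Hmax].
apply: two_group_perfect_code => // x /setIP[Gx Nx] Hx2.
have [Hx | notHx] := boolP (x \in H).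
  by exists 1; rewrite ?invg1 // mem_rcoset mul1g groupV.
have: z \in H <*> <[x]>.
  apply: contraR notHx => notKz; rewrite -cycle_subG.
  rewrite -(Hmax (H <*> <[x]>)%G) ?joing_subl ?joing_subr //.
  by rewrite join_subG sHG cycle_subG Gx.
rewrite norm_joinEr ?cycle_subG // => /mulsgP[h _ Hh /cycleP[i ->] def_z].
exists z; last by apply/eqP; rewrite eq_invg_mul -[z * z]/(z ^+ 2) -order_dvdn oz.
(* Only the parity of [i] matters modulo [H]; an even [i] would put [z] in [H]. *)
have Hxi: x ^+ (i./2.*2) \in H by rewrite -mul2n expgM groupX.
rewrite def_z -(odd_double_half i) addnC expgD in notHz *.
case: (odd i) in notHz *; last by rewrite mulg1 groupM in notHz.
by rewrite mem_rcoset expg1 mulgA mulgK groupM.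
Qed.

(** ['Ohm_1(G)] is generated by the involutions of the 2-group. This form gives access to
    [prime_Ohm1P]. *)
Lemma exists_unique_involutionP (gT : finGroupType) (G : {group gT}) :
  2.-group G -> (exists! x, x \in G /\ #[x] = 2) <-> #|'Ohm_1(G)| = 2.
Proof.
move=> p2G; split=> [[z [[Gz oz] zU]] | oG1].
  suffices ->: 'Ohm_1(G) = <[z]> by [].
  rewrite Ohm1Eprime; congr <<_>>; apply/setP=> x; rewrite !inE.
  apply/andP/eqP=> [[Gx pr_x] | ->]; last by rewrite Gz oz.
  apply/esym/zU; split=> //; apply/eqP.
  by have := mem_p_elt p2G Gx; rewrite /p_elt pnatE.
have [|z G1z oz] := @Cauchy _ 2 'Ohm_1(G)%G isT; first by rewrite oG1.
exists z; split=> [|x [Gx ox]]; first by rewrite (subsetP (Ohm_sub 1 G)).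
have G1x: x \in 'Ohm_1(G) by rewrite Ohm1Eprime mem_gen // inE Gx ox.
have defG1: 'Ohm_1(G) = <[z]>.
  by apply/esym/eqP; rewrite eqEcard cycle_subG G1z oG1 -orderE oz.
move: G1x; rewrite defG1 cycle2g // !inE => /orP[/eqP x1 | /eqP-> //].
by rewrite x1 order1 in ox.
Qed.

(** The order of a 2-group forces [n] to be a power of 2, which matches the presentation with the
    one in [Grp_quaternion]. *)
Lemma generalized_quaternion_classP (gT : finGroupType) (G : {group gT}) :
  2.-group G ->
  generalized_quaternion G <-> extremal_class G = Quaternion.
Proof.
move=> p2G.
split=> [[n [n_gt1 oG isoG]] | /quaternion_classP[[|[|[|m]]] // _ isoG]].
  apply/quaternion_classP.
  (* As [n] is at least 2, the order exceeds 4, so its exponent is at least 3. *)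
  have: (2 ^ 2)%N < #|G| by rewrite oG -[X in X < _]/(4 * 1)%N ltn_pmul2l.
  have [k oG2] := p_natP p2G; rewrite oG2 ltn_exp2l //.
  case: k oG2 => [|[|[|m]]] // oG2 _.
  have def_n: n = (2 ^ m.+1)%N.
    apply/eqP; rewrite -(eqn_pmul2l (isT : 0 < 4)) -oG oG2.
    by rewrite !expnS !mulnA.
  exists m.+3 => //; apply/(isoGrpP _ (Grp_quaternion (isT : 2 < m.+3))).
  rewrite card_quaternion //=; split=> //.
  by have := isoGrp_hom isoG; rewrite def_n -expnS.
exists (2 ^ m.+1)%N; split.
- by rewrite expnS leq_pmulr // expn_gt0.
- by rewrite (card_isog isoG) card_quaternion // !expnS !mulnA.
by rewrite -expnS; apply: isoGrp_trans isoG (Grp_quaternion (isT : 2 < m.+3)).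
Qed.

(** * Equivalence of the three conditions *)

Theorem theorem1p4 (gT : finGroupType) (G : {group gT})
    (G_gt1 : 1 < #|G|) (G_not_prime : ~~ prime #|G|) :
  let no_subgroup_code :=
    ~ (exists H : {group gT},
         [/\ H \proper G, H :!=: 1 & perfect_code_of G H]) in
  let two_group_unique_involution :=
    2.-group G /\ (exists! x, x \in G /\ #[x] = 2) in
  let cyclic_or_quaternion :=
    (cyclic G /\ 2.-group G) \/ (generalized_quaternion G /\ 2.-group G) in
  (no_subgroup_code <-> two_group_unique_involution) /\
  (two_group_unique_involution <-> cyclic_or_quaternion).
Proof.
have ntG: G :!=: 1 by rewrite -cardG_gt1.
cbv zeta; split; [split=> [noH | [p2G invG]] | split=> [[p2G invG] | cqG]].
- have p2G: 2.-group G.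
    (* A subgroup of odd prime order would be a code, and it is proper because [#|G|] is not
       prime. *)
    apply/pgroupP=> p pr_p /(Cauchy pr_p)[x Gx ox]; rewrite inE.
    apply: contraT => p_neq2; case: noH; exists <[x]>%G.
    have sxG: <[x]> \subset G by rewrite cycle_subG.
    split; last 1 first.
    + apply: odd_subgroup_perfect_code => //.
      rewrite -orderE ox; case: (even_prime pr_p) => // p2.
      by rewrite p2 in p_neq2.
    + rewrite properEcard sxG ltn_neqAle subset_leq_card // andbT -orderE ox.
      by apply: contraNneq G_not_prime => <-.
    by rewrite -cardG_gt1 -orderE ox prime_gt1.
  split=> //; have [_ dvd2G _] := pgroup_pdiv p2G ntG.
  have [z Gz oz] := Cauchy (isT : prime 2) dvd2G.
  exists z; split=> // t [Gt ot]; apply/eqP; apply: contraT => neq_zt.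
  (* Starting from [<[t]>] makes the maximal subgroup avoiding [z] nontrivial. *)
  have gPt: (<[t]> \subset G) && (z \notin <[t]>).
    rewrite cycle_subG Gt cycle2g // !inE negb_or neq_zt andbT.
    by rewrite -order_eq1 oz.
  have [H maxH stH] :=
    @maxgroup_exists _ (fun K => (K \subset G) && (z \notin K)) <[t]>%G gPt.
  case: noH; exists H; split.
  + have [/andP[sHG notHz] _] := maxgroupP maxH.
    by apply/properP; split=> //; exists z.
  + by apply: contraTneq stH => ->; rewrite cycle_subG inE -order_eq1 ot.
  exact: maxgroup_avoiding_perfect_code maxH.
- case=> H [prHG ntH /(subgroup_perfect_codeP _ _ _ (proper_sub prHG))].
  case=> T [sTG TV transT].
  have [z [_ zU]] := invG; have sHG := proper_sub prHG.
  have [|h Hh oh] := @Cauchy _ 2 H isT.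
    by have [_ dvd2H _] := pgroup_pdiv (pgroupS sHG p2G) ntH.
  have [x Nx [Hx2 notHx]] := exists_normaliser_expg_mem _ _ _ _ p2G prHG.
  have [Gx nHx] := setIP Nx.
  have [|t [/setIP[Tt Hxt] tU]] := transT x; first by rewrite inE notHx.
  (* [H :* x] is closed under inversion, so its unique point in [T] is self-inverse. *)
  have tV: t^-1 = t.
    apply/esym/tU; rewrite inE TV //= norm_rlcoset // mem_lcoset -invMg groupV.
    by rewrite -(mulgKV x t) -mulgA groupM // -mem_rcoset.
  have ot: #[t] = 2.
    apply: nt_prime_order => //; first by rewrite expgS expg1 -{1}tV mulVg.
    by apply: contraNneq notHx => t1; rewrite -groupV -[_^-1]mul1g -mem_rcoset -t1.
  (* Uniqueness of the involution puts [t] in [H], hence also [x], against the choice of [x]. *)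
  have eq_ht: h = t.
    rewrite -(zU h) ?(zU t) //; split=> //; first exact: subsetP Tt.
    exact: subsetP Hh.
  by rewrite mem_rcoset -eq_ht groupMl // groupV (negPf notHx) in Hxt.
(* [prime_Ohm1P] classifies the nontrivial p-groups whose first Ohm subgroup has order [p]: cyclic,
   or quaternion for [p = 2]. *)
- have := introT (@prime_Ohm1P _ 2 G p2G ntG).
  move/(exists_unique_involutionP _ _ p2G): invG => oG1 /(_ oG1).
  case/orP=> [cycG | /eqP quatG]; [by left | right; split=> //].
  exact/generalized_quaternion_classP.
have p2G: 2.-group G by case: cqG => -[].
split=> //; apply/exists_unique_involutionP => //.
apply/prime_Ohm1P => //; case: cqG => [[-> //] | [quatG _]].
by apply/orP; right; apply/eqP/generalized_quaternion_classP.
Qed.
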